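(* Let $P_1$ and $P_2$ be the dcpo's defined in the context. Then the Scott space $\Sigma(P_1\times P_2)$ of the product poset $P_1\times P_2$ (ordered componentwise) is not sober.
   Context: General notions. A dcpo is a poset in which every directed (nonempty) subset has a supremum. A subset $U$ of a poset $P$ is Scott open if it is an upper set and, for every directed $D\subseteq P$ whose supremum exists, $\sup D\in U$ implies $D\cap U\neq\emptyset$. The Scott open sets form the Scott topology $\sigma(P)$, and $\Sigma P=(P,\sigma(P))$. A $T_0$ space is sober if every nonempty irreducible closed subset is the closure of a unique singleton. $\mathbb{N}$ is the set of non-negative integers. For relations $R,S$, $R;S$ denotes the composition: $x\,(R;S)\,z$ iff there is $y$ with $x\,R\,y$ and $y\,S\,z$. Posets $\mathbb{N}^{<\mathbb{N}}$, $M$, $L$. $\mathbb{N}^{<\mathbb{N}}$ is the set of nonempty finite words over $\mathbb{N}$ with the prefix order. A word of length 1 may be identified with a natural number when indicated; $s.x$ denotes the word $s$ extended by the letter $x\in\mathbb{N}$. $M$ is the disjoint union $\mathbb{N}\cup\mathbb{N}^{<\mathbb{N}}$, where $x\le_M y$ iff either both are in $\mathbb{N}^{<\mathbb{N}}$ and $x$ is a prefix of $y$, or both are in $\mathbb{N}$ and $x\le y$ in the usual order. $L=(\{(a,b)\in\mathbb{N}\times\mathbb{N}:a<b\}\times M)\cup\{\top\}$, where $((a,b),x)\le((a',b'),y)$ iff $a=a'$, $b=b'$ and $x\le_M y$, and $u\le\top$ for all $u\in L$. Write $x_{a,b}$ for $((a,b),x)$. The maps $i$ and $f_{m,n}$.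 Fix an injection $i:\{(a,b)\in\mathbb{N}\times\mathbb{N}:a<b\}\to\mathcal{P}(\mathbb{N})$ such that: (1) $i(m_1,n_1)\cap i(m_2,n_2)=\emptyset$ if $(m_1,n_1)\neq(m_2,n_2)$; (2) $n<k$ for every $k\in i(m,n)$; (3) for all $m<n$ there is a monotone injective function $f_{m,n}:\mathbb{N}^{<\mathbb{N}}\to i(m,n)$ (with $i(m,n)\subseteq\mathbb{N}$ in its usual order). Fix such functions $f_{m,n}$. (Such $i$ and $f_{m,n}$ exist.) The poset $B$. $B=\mathbb{N}\times\mathbb{N}\times L$ as a set, with relations (for $a<b$ in $\mathbb{N}$ and $m,n\in\mathbb{N}$): - $(m,n,u)\sqsubset_1(m,n,v)$ whenever $u<v$ in $L$; - $(a,n,x_{a,b})\sqsubset_2(f_{a,b}(x),n+1,\top)$ for all $x\in\mathbb{N}^{<\mathbb{N}}$; - $(b,n,x_{a,b})\sqsubset_3(f_{a,b}(x),n+1,\top)$ for all $x\in\mathbb{N}$ (in $f_{a,b}(x)$, $x$ is read as a word of length 1); - $(f_{a,b}(s),n,x_{a,b})\sqsubset_4(f_{a,b}(s.x),n,\top)$ for all $s\in\mathbb{N}^{<\mathbb{N}}$ and $x\in\mathbb{N}$. Let $\sqsubset$ be $\sqsubset_1\cup\sqsubset_2\cup\sqsubset_3\cup\sqsubset_4\cup(\sqsubset_1;\sqsubset_2)\cup(\sqsubset_1;\sqsubset_3)\cup(\sqsubset_1;\sqsubset_4)$, and let $\sqsubseteq$ be the union of $\sqsubset$ and equality; this is a partial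 order on $B$. The dcpo $P_1$. Let $\mathbb{N}^{\mathbb{N}}$ be the set of all maps $\mathbb{N}\to\mathbb{N}$, and $P_1=(\mathbb{N}^{\mathbb{N}}\times\mathbb{N})\cup B\cup\{\top_1\}$ (disjoint union), with relations: - $(f,n)<_1(f,m)$ whenever $n<m$; - $<_2$ is $\sqsubset$ on $B$; - $(f,n)<_3(f(n),n,\top)$ for all $(f,n)\in\mathbb{N}^{\mathbb{N}}\times\mathbb{N}$; - $x<_4\top_1$ for all $x\in P_1\setminus\{\top_1\}$. The strict order on $P_1$ is $<_1\cup<_2\cup<_3\cup<_4\cup(<_1;<_3)$, and $\le$ is its union with equality. The dcpo $P_2$. Fix a bijection $\phi:\mathbb{N}\to\{(a,b)\in\mathbb{N}\times\mathbb{N}:a<b\}$ and put $E_n=i(\phi(n))$. Let $X$ be the set of all $f:\mathbb{N}\to\bigcup_{n\in\mathbb{N}}E_n$ with $f(n)\in E_n$ for every $n$. Let $P_2=(X\times\mathbb{N}\times\mathbb{N})\cup B\cup\{\top_2\}$ (disjoint union), with relations: - $(f,n,k)<_1(f,m,k)$ whenever $n<m$; - $<_2$ is $\sqsubset$ on $B$; - $(f,n,k)<_3(f(n),k,\top)$ for all $(f,n,k)\in X\times\mathbb{N}\times\mathbb{N}$; - $x<_4\top_2$ for all $x\in P_2\setminus\{\top_2\}$. The strict order on $P_2$ is $<_1\cup<_2\cup<_3\cup<_4\cup(<_1;<_3)$, and $\le$ is its union with equality. *)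

(* Defs.v *)
From HB Require Import structures.
From mathcomp Require Import all_boot all_order.
From mathcomp Require Import boolp classical_sets topology_structure separation_axioms.

Set Implicit Arguments.
Unset Strict Implicit.
Unset Printing Implicit Defensive.

Import Order.TTheory.
Local Open Scope classical_set_scope.

Section Scott.
Context {d : Order.disp_t} {P : porderType d}.
Implicit Types (x y s : P) (A D U V : set P).

Definition directed D :=
  D !=set0 /\
  forall x y, D x -> D y -> exists z, [/\ D z, (x <= z)%O & (y <= z)%O].

Definition upper_set U := forall x y, U x -> (x <= y)%O -> U y.

Definition scott_open U :=
  upper_set U /\
  forall D s, directed D -> supremums D s -> U s -> D `&` U !=set0.

Lemma scott_openT : scott_open setT.
Proof. by split=> // D s [[x Dx] _] _ _; exists x. Qed.

Lemma scott_openI : setI_closed scott_open.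
Proof.
move=> U V [uU oU] [uV oV]; split=> [x y [Ux Vx] xy|D s dD sD [Us Vs]].
  by split; [exact: uU xy|exact: uV xy].
have [x [Dx Ux]] := oU _ _ dD sD Us; have [y [Dy Vy]] := oV _ _ dD sD Vs.
have [z [Dz xz yz]] := dD.2 _ _ Dx Dy.
by exists z; do 2?split => //; [exact: uU xz|exact: uV yz].
Qed.

Lemma scott_open_bigU (I : Type) (F : I -> set P) :
  (forall i, scott_open (F i)) -> scott_open (\bigcup_i F i).
Proof.
move=> oF; split=> [x y [i _ Fx] xy|D s dD sD [i _ Fs]].
  by exists i => //; exact: (oF i).1 xy.
by have [x [Dx Fx]] := (oF i).2 _ _ dD sD Fs; exists x; split=> //; exists i.
Qed.

End Scott.

Definition Sigma {d : Order.disp_t} (P : porderType d) : Type := P.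

Section SigmaTopology.
Context {d : Order.disp_t} (P : porderType d).

HB.instance Definition _ := Choice.copy (Sigma P) P.
HB.instance Definition _ := isOpenTopological.Build (Sigma P)
  (@scott_openT d P) (@scott_openI d P) (@scott_open_bigU d P).

Lemma open_SigmaE : (open : set_system (Sigma P)) = @scott_open d P.
Proof.
apply/funext => U; apply/propext; split=> [oU|oU].
  have -> : U = \bigcup_(V : {V | scott_open V /\ V `<=` U}) (sval V).
    apply/seteqP; split=> [x Ux|x [[V [? VU]] _]]; last exact: VU.
    have [V [oV Vx VU]] : nbhs (x : Sigma P) U.
      exact: (open_nbhs_nbhs (conj oU Ux)).
    by exists (exist (fun V => scott_open V /\ V `<=` U) V (conj oV VU)).
  by apply: scott_open_bigU => -[V []].
by rewrite openE => x Ux; exists U; split=> //.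
Qed.

Lemma Sigma_kolmogorov : kolmogorov_space (Sigma P).
Proof.
have sep (x y : Sigma P) : ~~ ((x : P) <= (y : P))%O ->
    exists A : set (Sigma P), A \in nbhs x /\ y \in ~` A.
  move=> xy; exists [set z : P | ~~ (z <= y)%O]; split.
    rewrite inE; apply: open_nbhs_nbhs; split=> //; rewrite open_SigmaE.
    split=> [u v /= uy uv|D s _ [_ sD] /= sy].
      by apply: contra uy; exact: le_trans.
    apply: contrapT => DU; move/negP: sy; apply; apply: sD => u Du.
    by apply: contrapT => /negP uy; apply: DU; exists u.
  by rewrite inE /= => /negP; apply.
move=> x y; rewrite (@eq_le d P) negb_and => /orP[] /sep[A HA]; exists A;
  by [left|right].
Qed.

End SigmaTopology.

Definition irreducible_set {T : topologicalType} (A : set T) :=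
  A !=set0 /\
  forall F G : set T, closed F -> closed G ->
    A `<=` F `|` G -> A `<=` F \/ A `<=` G.

(* Sobriety is usually defined for T0 spaces only; the T0 axiom is not repeated
   here since it holds for all Scott spaces, cf. [Sigma_kolmogorov] (and is a
   consequence of the uniqueness of the generic points). *)
Definition sober (T : topologicalType) :=
  forall A : set T, closed A -> irreducible_set A ->
    exists! x, A = closure [set x].

Definition word := {s : seq nat | s != [::]}.

Definition word_le (s t : word) : bool := prefix (val s) (val t).

Definition word1 (x : nat) : word := exist _ [:: x] isT.

Lemma rcons_neq0 (s : seq nat) (x : nat) : rcons s x != [::].
Proof. by case: s. Qed.

Definition word_rcons (s : word) (x : nat) : word :=
  exist _ (rcons (val s) x) (rcons_neq0 (val s) x).

Definition M := (nat + word)%type.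

Definition leM (x y : M) : bool :=
  match x, y with
  | inl m, inl n => (m <= n)%N
  | inr s, inr t => word_le s t
  | _, _ => false
  end.

Definition ltpair := {p : nat * nat | (p.1 < p.2)%N}.
Definition pfst (p : ltpair) : nat := (val p).1.
Definition psnd (p : ltpair) : nat := (val p).2.

(* [None] is the top element. *)
Definition L := option (ltpair * M).
Definition Ltop : L := None.
Definition Lnat (p : ltpair) (x : nat) : L := Some (p, inl x).
Definition Lword (p : ltpair) (s : word) : L := Some (p, inr s).

Definition leL (u v : L) : bool :=
  match u, v with
  | _, None => true
  | None, Some _ => false
  | Some (p, x), Some (q, y) => (p == q) && leM x y
  end.

Definition ltL (u v : L) : bool := (u != v) && leL u v.

Lemma leM_refl : reflexive leM.
Proof. by case=> [m|s] /=; [exact: leqnn|exact: prefix_refl]. Qed.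

Lemma leM_trans : transitive leM.
Proof. by move=> [m|s] [n|t] [p|r] //=; [exact: leq_trans|exact: prefix_trans]. Qed.

Lemma leM_anti : antisymmetric leM.
Proof.
move=> [m|s] [n|t] //=; first by rewrite -eqn_leq => /eqP ->.
move=> /andP[/prefixP[a ta] /prefixP[b sb]]; congr inr; apply/val_inj => /=.
have : size b = 0%N.
  have /eqP := congr1 size sb.
  by rewrite ta !size_cat -addnA -{1}[size (val s)]addn0 eqn_add2l eq_sym addn_eq0;
     case/andP=> _ /eqP.
by move=> /size0nil b0; rewrite sb b0 cats0.
Qed.

Lemma leL_refl : reflexive leL.
Proof. by case=> [[p x]|] //=; rewrite eqxx leM_refl. Qed.

Lemma leL_trans : transitive leL.
Proof.
move=> [[p x]|] [[q y]|] [[r z]|] //= /andP[/eqP -> yx] /andP[/eqP -> xz].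
by rewrite eqxx (leM_trans yx xz).
Qed.

Lemma leL_anti : antisymmetric leL.
Proof.
move=> [[p x]|] [[q y]|] //= /andP[/andP[/eqP -> xy] /andP[_ yx]].
by rewrite (@leM_anti x y) // xy.
Qed.

Lemma ltL_irr : irreflexive ltL.
Proof. by move=> u; rewrite /ltL eqxx. Qed.

Lemma ltL_trans : transitive ltL.
Proof.
move=> v u w /andP[uv luv] /andP[vw lvw]; rewrite /ltL (leL_trans luv lvw) andbT.
apply: contra uv => /eqP uw; subst w.
by apply/eqP/leL_anti; rewrite luv.
Qed.

Definition relcomp (T : Type) (R S : T -> T -> Prop) (x z : T) : Prop :=
  exists2 y, R x y & S y z.

Definition B := (nat * nat * L)%type.

Inductive sq1 : B -> B -> Prop :=
| Sq1 m n u v of ltL u v : sq1 (m, n, u) (m, n, v).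

Lemma sq1E (x y : B) : sq1 x y <-> x.1 = y.1 /\ ltL x.2 y.2.
Proof.
split=> [[m n u v uv] //|]; case: x y => [[m n] u] [[k l] v] /= [[<- <-] uv].
exact: Sq1.
Qed.

Section StrictOrderB.
Variable f : ltpair -> word -> nat.

Inductive sq2 : B -> B -> Prop :=
| Sq2 (p : ltpair) (n : nat) (x : word) :
    sq2 (pfst p, n, Lword p x) (f p x, n.+1, Ltop).

Inductive sq3 : B -> B -> Prop :=
| Sq3 (p : ltpair) (n : nat) (x : nat) :
    sq3 (psnd p, n, Lnat p x) (f p (word1 x), n.+1, Ltop).

Inductive sq4 : B -> B -> Prop :=
| Sq4 (p : ltpair) (n : nat) (s : word) (x : nat) :
    sq4 (f p s, n, Lnat p x) (f p (word_rcons s x), n, Ltop).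

Definition sqlt (x y : B) : Prop :=
  sq1 x y \/ sq2 x y \/ sq3 x y \/ sq4 x y \/
  relcomp sq1 sq2 x y \/ relcomp sq1 sq3 x y \/ relcomp sq1 sq4 x y.

Lemma sqltE (x y : B) :
  sqlt x y <-> sq1 x y \/
    exists2 z, x = z \/ sq1 x z & sq2 z y \/ sq3 z y \/ sq4 z y.
Proof.
split.
  case=> [h|[h|[h|[h|[[z h1 h2]|[[z h1 h2]|[z h1 h2]]]]]]]; first by left.
  - by right; exists x; tauto.
  - by right; exists x; tauto.
  - by right; exists x; tauto.
  - by right; exists z; tauto.
  - by right; exists z; tauto.
  - by right; exists z; tauto.
case=> [h|[z [<-|h1] [h2|[h2|h2]]]]; rewrite /sqlt; try tauto.
- by do 4!right; left; exists z.
- by do 5!right; left; exists z.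
- by do 6!right; exists z.
Qed.

Lemma sqlt_top m n y : ~ sqlt (m, n, Ltop) y.
Proof.
have s1 z : ~ sq1 (m, n, Ltop) z.
  by rewrite sq1E => -[_] /=; case: z.2.
rewrite sqltE => -[/s1//|[z [<-|/s1//]]].
by case=> [h|[h|h]]; inversion h.
Qed.

Lemma sqlt_cases x y : sqlt x y -> sq1 x y \/ exists m n, y = (m, n, Ltop).
Proof.
rewrite sqltE => -[|[z _]]; first by left.
by case=> [h|[h|h]]; inversion h; right; do 2!eexists.
Qed.

Lemma sqlt_irr x : ~ sqlt x x.
Proof.
move=> h; case: (sqlt_cases h) => [h1|[m [n xE]]].
  by move: h1; rewrite sq1E ltL_irr => -[].
by move: h; rewrite xE => /sqlt_top.
Qed.

Lemma sq1_trans x y z : sq1 x y -> sq1 y z -> sq1 x z.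
Proof.
by rewrite !sq1E => -[-> xy] [-> yz]; split=> //; exact: ltL_trans yz.
Qed.

Lemma sqlt_trans x y z : sqlt x y -> sqlt y z -> sqlt x z.
Proof.
move=> xy; case: (sqlt_cases xy) => [xy1|[m [n ->]] /sqlt_top//].
rewrite !sqltE => -[yz|[t yt tz]]; first by left; exact: sq1_trans yz.
right; exists t => //; right.
by case: yt => [<-//|yt]; exact: sq1_trans yt.
Qed.

End StrictOrderB.

(* [f] is a parameter of the carrier so that the order can be attached to it. *)
Inductive P1 (f : ltpair -> word -> nat) : Type :=
| P1fun of (nat -> nat) & nat
| P1B of B
| P1top.

Section P1Order.
Variable f : ltpair -> word -> nat.

Inductive P1lt1 : P1 f -> P1 f -> Prop :=
| P1Lt1 (g : nat -> nat) (n m : nat) of (n < m)%N :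
    P1lt1 (P1fun f g n) (P1fun f g m).

Inductive P1lt2 : P1 f -> P1 f -> Prop :=
| P1Lt2 (x y : B) of sqlt f x y : P1lt2 (P1B f x) (P1B f y).

Inductive P1lt3 : P1 f -> P1 f -> Prop :=
| P1Lt3 (g : nat -> nat) (n : nat) :
    P1lt3 (P1fun f g n) (P1B f (g n, n, Ltop)).

Inductive P1lt4 : P1 f -> P1 f -> Prop :=
| P1Lt4 (x : P1 f) of x <> P1top f : P1lt4 x (P1top f).

Definition P1lt (x y : P1 f) : Prop :=
  P1lt1 x y \/ P1lt2 x y \/ P1lt3 x y \/ P1lt4 x y \/ relcomp P1lt1 P1lt3 x y.

Lemma P1ltE (x y : P1 f) : P1lt x y <->
  match x, y with
  | P1fun g n, P1fun h m => g = h /\ (n < m)%N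
  | P1fun g n, P1B b => exists2 m, (n <= m)%N & b = (g m, m, Ltop)
  | P1B b, P1B c => sqlt f b c
  | P1top, _ => False
  | _, P1top => True
  | _, _ => False
  end.
Proof.
split=> [|].
  case=> [[g n m //]|[[b c //]|[[g n]|[[z zT]|[t [g n m nm] h]]]]].
  - by exists n.
  - by case: z zT.
  - by inversion h; exists m => //; exact: ltnW.
case: x y => [g n|b|] [h m|c|] //=.
- by case=> <- nm; left.
- case=> m; rewrite leq_eqVlt => /orP[/eqP <-|nm] ->.
    by do 2!right; left.
  by do 4!right; exists (P1fun f g m).
- by move=> _; do 3!right; left.
- by right; left.
- by move=> _; do 3!right; left.
Qed.

Lemma P1lt_irr x : ~ P1lt x x.
Proof.
by rewrite P1ltE; case: x => [g n|b|] //; [rewrite ltnn => -[]|exact: sqlt_irr].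
Qed.

Lemma P1lt_trans x y z : P1lt x y -> P1lt y z -> P1lt x z.
Proof.
rewrite !P1ltE; case: x y z => [g n|b|] [h m|c|] [k p|e|] //=.
- by case=> -> nm [-> mp]; split=> //; exact: ltn_trans mp.
- by case=> -> nm [q mq ->]; exists q => //; exact/ltnW/(leq_trans nm).
- by case=> q _ -> /sqlt_top.
- exact: sqlt_trans.
Qed.

HB.instance Definition _ := gen_eqMixin (P1 f).
HB.instance Definition _ := gen_choiceMixin (P1 f).

Fact P1lt_irrb : irreflexive (fun x y : P1 f => `[< P1lt x y >]).
Proof. by move=> x; apply/asboolP; exact: P1lt_irr. Qed.

Fact P1lt_transb : transitive (fun x y : P1 f => `[< P1lt x y >]).
Proof.
by move=> y x z /asboolP xy /asboolP yz; apply/asboolP; exact: P1lt_trans yz.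
Qed.

HB.instance Definition _ :=
  Order.Lt_isPOrder.Build (Order.Disp tt tt) (P1 f) P1lt_irrb P1lt_transb.

Lemma lt_P1E (x y : P1 f) : (x < y)%O <-> P1lt x y.
Proof. by split=> [/asboolP|?] //; apply/asboolP. Qed.

Lemma le_P1E (x y : P1 f) : (x <= y)%O <-> P1lt x y \/ x = y.
Proof.
rewrite le_eqVlt -lt_P1E; split=> [/orP[/eqP|]|[->|->]]; rewrite ?eqxx ?orbT //.
- by right.
- by left.
Qed.

End P1Order.

Definition E (i : ltpair -> set nat) (phi : nat -> ltpair) (n : nat) : set nat :=
  i (phi n).

(* [E n] is a subset of the union of the [E m], so maps into the union are
   represented as maps into [nat]. *)
Definition X (i : ltpair -> set nat) (phi : nat -> ltpair) :=
  {g : nat -> nat | forall n, E i phi n (g n)}.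

Inductive P2 (i : ltpair -> set nat) (f : ltpair -> word -> nat)
    (phi : nat -> ltpair) : Type :=
| P2fun of X i phi & nat & nat
| P2B of B
| P2top.

Section P2Order.
Variables (i : ltpair -> set nat) (f : ltpair -> word -> nat).
Variable phi : nat -> ltpair.
Local Notation XX := (X i phi).
Local Notation PP := (P2 i f phi).
Local Notation Pfun := (@P2fun i f phi).
Local Notation PB := (@P2B i f phi).
Local Notation Ptop := (@P2top i f phi).

Inductive P2lt1 : PP -> PP -> Prop :=
| P2Lt1 (g : XX) (n m k : nat) of (n < m)%N :
    P2lt1 (Pfun g n k) (Pfun g m k).

Inductive P2lt2 : PP -> PP -> Prop :=
| P2Lt2 (x y : B) of sqlt f x y : P2lt2 (PB x) (PB y).

Inductive P2lt3 : PP -> PP -> Prop :=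
| P2Lt3 (g : XX) (n k : nat) :
    P2lt3 (Pfun g n k) (PB (sval g n, k, Ltop)).

Inductive P2lt4 : PP -> PP -> Prop :=
| P2Lt4 (x : PP) of x <> Ptop : P2lt4 x Ptop.

Definition P2lt (x y : PP) : Prop :=
  P2lt1 x y \/ P2lt2 x y \/ P2lt3 x y \/ P2lt4 x y \/ relcomp P2lt1 P2lt3 x y.

Lemma P2ltE (x y : PP) : P2lt x y <->
  match x, y with
  | P2fun g n k, P2fun h m l => [/\ g = h, k = l & (n < m)%N]
  | P2fun g n k, P2B b =>
      exists2 m, (n <= m)%N & b = (sval g m, k, Ltop)
  | P2B b, P2B c => sqlt f b c
  | P2top, _ => False
  | _, P2top => True
  | _, _ => False
  end.
Proof.
split=> [|].
  case=> [[g n m //]|[[b c //]|[[g n k]|[[z zT]|[t [g n m k nm] h]]]]].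
  - by exists n.
  - by case: z zT.
  - by inversion h; exists m => //; exact: ltnW.
case: x y => [g n k|b|] [h m l|c|] //=.
- by case=> <- <- nm; left.
- case=> m; rewrite leq_eqVlt => /orP[/eqP <-|nm] ->.
    by do 2!right; left.
  by do 4!right; exists (Pfun g m k).
- by move=> _; do 3!right; left.
- by right; left.
- by move=> _; do 3!right; left.
Qed.

Lemma P2lt_irr x : ~ P2lt x x.
Proof.
by rewrite P2ltE; case: x => [g n k|b|] //; [rewrite ltnn => -[]|exact: sqlt_irr].
Qed.

Lemma P2lt_trans x y z : P2lt x y -> P2lt y z -> P2lt x z.
Proof.
rewrite !P2ltE; case: x y z => [g n k|b|] [h m l|c|] [g' p q|e|] //=.
- by case=> -> -> nm [-> -> mp]; split=> //; exact: ltn_trans mp.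
- by case=> -> -> nm [r mr ->]; exists r => //; exact/ltnW/(leq_trans nm).
- by case=> r _ -> /sqlt_top.
- exact: sqlt_trans.
Qed.

HB.instance Definition _ := gen_eqMixin PP.
HB.instance Definition _ := gen_choiceMixin PP.

Fact P2lt_irrb : irreflexive (fun x y : PP => `[< P2lt x y >]).
Proof. by move=> x; apply/asboolP; exact: P2lt_irr. Qed.

Fact P2lt_transb : transitive (fun x y : PP => `[< P2lt x y >]).
Proof.
by move=> y x z /asboolP xy /asboolP yz; apply/asboolP; exact: P2lt_trans yz.
Qed.

HB.instance Definition _ :=
  Order.Lt_isPOrder.Build (Order.Disp tt tt) PP P2lt_irrb P2lt_transb.

Lemma lt_P2E (x y : PP) : (x < y)%O <-> P2lt x y.
Proof. by split=> [/asboolP|?] //; apply/asboolP. Qed.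

Lemma le_P2E (x y : PP) : (x <= y)%O <-> P2lt x y \/ x = y.
Proof.
rewrite le_eqVlt -lt_P2E; split=> [/orP[/eqP|]|[->|->]]; rewrite ?eqxx ?orbT //.
- by right.
- by left.
Qed.

End P2Order.

(* Main.v *)
Require Import Defs.
From mathcomp Require Import all_boot all_order.
From mathcomp Require Import boolp classical_sets topology_structure.

(* Let A be the set of pairs lying below some (t, t) with t = (j, l, top) in B.
   A is Scott closed: the t dominating a given pair (x, y) are finite in number,
   unless x = (c, x_p) and y = (c', y_p) for the same p and c or c' is itself
   such a t; in both cases finitely many t suffice for everything above (x, y)
   in a directed subset of A, so one of them bounds the whole subset. The maps
   in P1 and P2 cause no harm because those in P1 meet every level l once, while
   those in P2 stay in one level and meet each i(p) once.
   A is irreducible: two open sets containing (t, t) and (t', t') can be moved to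
   a common level, where the relations of B for the pair (j, j') make them meet.
   A has no greatest element, so it is not the closure of a point. *)

Set Implicit Arguments.
Unset Strict Implicit.
Unset Printing Implicit Defensive.

Import Order.TTheory.
Local Open Scope classical_set_scope.

(** * Directed sets and closures of points *)

Section DirectedSets.
Context {d : Order.disp_t} {P : porderType d}.
Implicit Types (D U V : set P) (x y : P).

Lemma directed_chain (u : nat -> P) :
  (forall m n, (m <= n)%N -> (u m <= u n)%O) -> directed (range u).
Proof.
move=> u_mono; split; first by exists (u 0); exists 0.
move=> _ _ [m _ <-] [n _ <-]; exists (u (maxn m n)).
by split; [exists (maxn m n)|apply/u_mono/leq_maxl|apply/u_mono/leq_maxr].
Qed.

(** If each [t] in [S] failed at some element of [D], finitely many uses of directedness would give
    one element above [x] where all of [S] fails. *)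
Lemma directed_common_bound (T : eqType) (R : P -> T -> Prop) (S : seq T) D x :
    (forall y z t, (y <= z)%O -> R z t -> R y t) ->
    directed D -> D x ->
    (forall y, D y -> (x <= y)%O -> exists2 t, t \in S & R y t) ->
  exists t, forall y, D y -> R y t.
Proof.
move=> R_anti [_ dD] Dx DS; apply: contrapT => noR.
have bad t : exists2 y, D y & ~ R y t.
  apply: contrapT => allR; apply: noR; exists t => y Dy.
  by apply: contrapT => Ryt; apply: allR; exists y.
have [y [Dy xy yS]] : exists y, [/\ D y, (x <= y)%O & forall t, t \in S -> ~ R y t].
  elim: S {DS} => [|t S [y [Dy xy yS]]]; first by exists x.
  have [z Dz zt] := bad t; have [v [Dv yv zv]] := dD _ _ Dy Dz.
  exists v; split=> // [|t']; first exact: le_trans yv.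
  rewrite inE => /orP[/eqP->|/yS ys] Rv; first exact: zt (R_anti _ _ _ zv Rv).
  exact: ys (R_anti _ _ _ yv Rv).
by have [t /yS yt Ryt] := DS _ Dy xy.
Qed.

Lemma closure1_le (x y : Sigma P) :
  closure [set x] y -> ((y : P) <= (x : P))%O.
Proof.
rewrite closureE => /(_ [set z : P | (z <= (x : P))%O]); apply.
split=> [|_ ->]; last exact: le_refl.
rewrite -openC open_SigmaE; split=> [u v ux uv vx|D s _ [_ s_lub] sx].
  exact: ux (le_trans uv vx).
apply: contrapT => Dx; apply: sx; apply: s_lub => u Du.
by apply: contrapT => ux; apply: Dx; exists u.
Qed.

End DirectedSets.

Lemma le_prodE (d1 d2 d3 : Order.disp_t) (T1 : porderType d1)
    (T2 : porderType d2) (x y : T1 *prod[d3] T2) :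
  (x <= y)%O <-> (x.1 <= y.1)%O /\ (x.2 <= y.2)%O.
Proof. by rewrite Order.ProdOrder.leEprod; split=> /andP. Qed.

(** * The order of [B] below the tops of its levels *)

Section Counterexample.
Variables (i : ltpair -> set nat) (f : ltpair -> word -> nat).
Variable phi : nat -> ltpair.
Hypothesis i_disj : forall p q : ltpair, p <> q -> i p `&` i q = set0.
Hypothesis f_in : forall (p : ltpair) (s : word), i p (f p s).
Hypothesis f_inj : forall p : ltpair, injective (f p).
Hypothesis phi_bij : bijective phi.

Lemma i_eq p q k : i p k -> i q k -> p = q.
Proof.
move=> pk qk; apply: contrapT => /i_disj /seteqP[/(_ k) pq _].
exact: pq.
Qed.

Lemma f_eq p q s t : f p s = f q t -> p = q /\ s = t.
Proof.
move=> e; have pq : p = q.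
  by apply: (@i_eq _ _ (f p s)) => //; rewrite e.
by split=> //; move: e; rewrite pq => /f_inj.
Qed.

Definition sqle (b c : B) := b = c \/ sqlt f b c.

Definition top_of (d : nat * nat) : B := (d, Ltop).

(* [escape c p w s l]: the element [(c, w_p)] of [B] lies, because of the
   relations [sq2], [sq3] and [sq4], below the top of level [l] indexed by
   [f p s]. *)
Definition escape (c : nat * nat) (p : ltpair) (w : M) (s : word) (l : nat) :=
  match w with
  | inr t => [/\ c.1 = pfst p, l = c.2.+1 & word_le t s]
  | inl x =>
      [/\ c.1 = psnd p, l = c.2.+1 & exists2 k, (x <= k)%N & s = word1 k] \/
      l = c.2 /\ exists t k, [/\ c.1 = f p t, (x <= k)%N & s = word_rcons t k]
  end.

Lemma sq1_leM c p v w :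
  (c, Some (p, v)) = (c, Some (p, w)) :> B \/
    sq1 (c, Some (p, v)) (c, Some (p, w)) <->
  leM v w.
Proof.
rewrite sq1E /ltL /= eqxx /=; split.
  by case=> [[->]|[_ /andP[]//]]; exact: leM_refl.
move=> vw; have [->|nvw] := eqVneq v w; first by left.
right; split=> //; rewrite vw andbT.
by apply: contra nvw => /eqP[->].
Qed.

Lemma sqle_top_of c p w d :
  sqle (c, Some (p, w)) (top_of d) <->
  d = c \/ exists2 s, d.1 = f p s & escape c p w s d.2.
Proof.
case: c d => m n [j l]; rewrite /sqle /top_of; split.
  case=> [//|]; rewrite sqltE sq1E /= => -[[[-> ->]]|]; first by left.
  case=> -[[m' n'] u] mz zd; right.
  (* The optional [sq1] step stays inside one copy of [L] and cannot end at its top, since no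
     relation leaves a top. *)
  have [v [uE mE wv]] : exists v, [/\ u = Some (p, v), (m', n') = (m, n) & leM w v].
    case: mz => [[<- <- <-]|]; first by exists w; rewrite leM_refl.
    rewrite sq1E /= => -[mn /andP[_]]; case: u zd => [[q v]|] zd /=.
      by case/andP=> /eqP<- wv; exists v.
    by case: zd => [h|[h|h]]; inversion h.
  case: mE zd => -> ->; rewrite uE.
  case=> [h|[h|h]]; inversion h; subst.
  - exists x => //; case: w wv {mz} => //= t tx; split=> //.
  - exists (word1 x) => //; case: w wv {mz} => //= y yx; left; split=> //.
    by exists x.
  - exists (word_rcons s x) => //; case: w wv {mz} => //= y yx; right.
    by split=> //; exists s, x.
case=> [->|/= [s ->]].
  by right; left; rewrite sq1E.
have via v : leM w v ->
    (sq2 f (m, n, Some (p, v)) (f p s, l, Ltop) \/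
     sq3 f (m, n, Some (p, v)) (f p s, l, Ltop) \/
     sq4 f (m, n, Some (p, v)) (f p s, l, Ltop)) ->
    sqlt f (m, n, Some (p, w)) (f p s, l, Ltop).
  by move=> wv h; rewrite sqltE; right; exists (m, n, Some (p, v)); rewrite ?sq1_leM.
case: w via => [x|t] via /=.
  case=> [[mE lE [k xk sE]]|[lE [t [k [mE xk sE]]]]]; right; subst.
    by apply: (via (inl k)) => //; right; left; exact: Sq3.
  by apply: (via (inl k)) => //; right; right; exact: Sq4.
case=> mE lE ts; right; subst; apply: (via (inr s)) => //; left; exact: Sq2.
Qed.

(** The word [s] alone bounds every element that escapes to the top indexed by [f p s], so an
    unbounded branch cannot escape to one and the same top. *)
Lemma escape_bound c p w s l :
  escape c p w s l -> leM w (inr s) \/ leM w (inl (last 0 (val s))).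
Proof.
case: w => [x|t] /=; last by case; left.
by case=> [[_ _ [k xk ->]]|[_ [t [k [_ xk ->]]]]]; right; rewrite /= ?last_rcons.
Qed.

Lemma word_le1 s k : word_le s (word1 k) -> s = word1 k.
Proof.
case: s => -[|x [|y s]] // s0; rewrite /word_le /=.
  by rewrite andbT => /eqP xk; apply/val_inj; rewrite /= xk.
by rewrite andbF.
Qed.

Lemma word_le_rcons s t k :
  word_le s (word_rcons t k) -> s = word_rcons t k \/ word_le s t.
Proof.
rewrite /word_le /= => /prefixP[u]; case/lastP: u => [|u x].
  by rewrite cats0 => e; left; apply/val_inj.
by rewrite -rcons_cat => /rcons_inj[-> _]; right; exact: prefix_prefix.
Qed.

Lemma word1_rcons k t x : word1 k <> word_rcons t x.
Proof. by case: t => -[//|y [|z t]] t0 /(congr1 val). Qed.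

Lemma word_rcons_inj s t x y : word_rcons s x = word_rcons t y -> s = t.
Proof. by move=> /(congr1 val) /= /rcons_inj[e _]; exact/val_inj. Qed.

(** * Finiteness of the tops above a pair *)

Definition finitely_many (T : eqType) (Q : T -> Prop) :=
  exists S : seq T, forall t, Q t -> t \in S.

Lemma common_tops c c' (v v' : ltpair * M) :
  [\/ finitely_many (fun d : nat * nat =>
         sqle (c, Some v) (top_of d) /\ sqle (c', Some v') (top_of d)),
      sqle (c', Some v') (top_of c) |
      sqle (c, Some v) (top_of c')].
Proof.
case: v v' => p w [p' w'].
have [<-|/eqP cc'] := eqVneq c c'.
  by constructor 2; apply/sqle_top_of; left.
(* Apart from [c] and [c'], a common top has index [f p s], which determines [p] and [s], and level
   [c.2] or [c.2.+1]; only [s] remains to be confined to a finite list. *)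
have fin_or (S : seq word) : (forall s l, p = p' ->
    escape c p w s l -> escape c' p w' s l -> s \in S) ->
  finitely_many (fun d : nat * nat =>
        sqle (c, Some (p, w)) (top_of d) /\ sqle (c', Some (p', w')) (top_of d)).
  move=> escS; exists [:: c, c' & [seq (f p s, l) | s <- S, l <- [:: c.2; c.2.+1]]].
  move=> d [/sqle_top_of [->|[s ds es]] /sqle_top_of]; rewrite !inE ?eqxx ?orbT //.
  case=> [->|[s' ds' es']]; rewrite ?eqxx ?orbT //.
  have [pp ss] : p = p' /\ s = s' by apply: f_eq; rewrite -ds.
  subst p' s'; apply/orP; right; apply/orP; right; apply/allpairsP.
  exists (s, d.2); split=> /=; last by rewrite -ds; exact: surjective_pairing.
    exact: (escS _ d.2).
  by case: w es {escS} => [x [[_ ->]|[->]]|t [_ ->]]; rewrite !inE eqxx ?orbT.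
have pairE (a b : nat * nat) : a.1 = b.1 -> a.2 = b.2 -> a = b.
  by case: a b => ? ? [? ?] /= -> ->.
(* If [s] extends [t] and arises from [sq4] as [u] followed by a letter, then either [s = t] or [t]
   is a prefix of [u]; in the latter case [sq2] puts the word element below the top of [b']. *)
have mixed q b b' t x : ~ sqle (b, Some (q, inr t)) (top_of b') ->
    forall s l, escape b q (inr t) s l -> escape b' q (inl x) s l -> s = t.
  move=> nle s l [b1 -> ts]; case=> [[_ _ [k _ sE]]|[b'2 [u [k [b'1 _ sE]]]]]; subst s.
    by rewrite (word_le1 ts).
  case: (word_le_rcons ts) => [->//|tu]; case: nle; apply/sqle_top_of; right.
  by exists u.
(* For two naturals or two words, a common [s] and [l] determine the position in [B], forcing
   [c = c']. *)
case: w w' fin_or => [x|s] [y|t] fin_or.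
- constructor 1; apply: (fin_or [::]) => s l _.
  case=> [[c1 -> [k _ ->]]|[-> [u [k [c1 _ ->]]]]].
  + case=> [[c'1 [c2] _]|[_ [u [k' [_ _ /word1_rcons//]]]]].
    by case: cc'; apply: pairE; rewrite ?c1 ?c'1.
  + case=> [[_ _ [k' _ /esym/word1_rcons//]]|[c2 [u' [k' [c'1 _ /word_rcons_inj uu]]]]].
    by case: cc'; apply: pairE; rewrite // c1 c'1 uu.
- have [|nle] := pselect (sqle (c', Some (p', inr t)) (top_of c)); first by constructor 2.
  constructor 1; apply: (fin_or [:: t]) => s l pp e1 e2; subst p'.
  by rewrite inE (mixed p c' c t x nle s l).
- have [|nle] := pselect (sqle (c, Some (p, inr s)) (top_of c')); first by constructor 3.
  constructor 1; apply: (fin_or [:: s]) => u l pp e1 e2.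
  by rewrite inE (mixed p c c' s y nle u l).
- constructor 1; apply: (fin_or [::]) => u l _ [c1 -> _] [c'1 [c2] _].
  by case: cc'; apply: pairE; rewrite ?c1 ?c'1.
Qed.

Local Notation P1P2 := (P1 f *p P2 i f phi)%type.

Definition diag (b : B) : P1P2 := (P1B f b, P2B i f phi b).

Lemma le_P1B x c : (x <= P1B f c)%O <->
  match x with
  | P1fun g n => exists2 m, (n <= m)%N & c = top_of (g m, m)
  | P1B b => sqle b c
  | P1top => False
  end.
Proof.
rewrite le_P1E P1ltE; case: x => [g n|b|]; split=> //.
- by case.
- by left.
- by case=> [|[->]]; [right|left].
- by case=> [->|]; [right|left].
- by case.
Qed.

Lemma le_P2B x c : (x <= P2B i f phi c)%O <->
  match x with
  | P2fun g n k => exists2 m, (n <= m)%N & c = top_of (sval g m, k)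
  | P2B b => sqle b c
  | P2top => False
  end.
Proof.
rewrite le_P2E P2ltE; case: x => [g n k|b|]; split=> //.
- by case.
- by left.
- by case=> [|[->]]; [right|left].
- by case=> [->|]; [right|left].
- by case.
Qed.

Lemma P1B_le b y : (P1B f b <= y)%O <->
  match y with P1fun _ _ => False | P1B c => sqle b c | P1top => True end.
Proof.
case: y => [g n|c|]; first by rewrite le_P1E P1ltE; split=> // -[].
  exact: le_P1B.
by rewrite le_P1E P1ltE; split=> // _; left.
Qed.

Lemma P2B_le b y : (P2B i f phi b <= y)%O <->
  match y with P2fun _ _ _ => False | P2B c => sqle b c | P2top => True end.
Proof.
case: y => [g n k|c|]; first by rewrite le_P2E P2ltE; split=> // -[].
  exact: le_P2B.
by rewrite le_P2E P2ltE; split=> // _; left.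
Qed.

Lemma diag_le b c : sqle b c -> (diag b <= diag c)%O.
Proof. by move=> bc; apply/le_prodE; rewrite le_P1B le_P2B. Qed.

Lemma top_of_le c b : sqle (top_of c) b -> b = top_of c.
Proof. by case=> [<-//|]; case: c => m n /sqlt_top. Qed.

Lemma common_tops_pair (z : P1P2) :
  finitely_many (fun d => (z <= diag (top_of d))%O) \/
  exists c c' v v', z = (P1B f (c, Some v), P2B i f phi (c', Some v')) /\
    ((z <= diag (top_of c))%O \/ (z <= diag (top_of c'))%O).
Proof.
have finP (S : seq (nat * nat)) :
    (forall d, (z.1 <= P1B f (top_of d))%O ->
       (z.2 <= P2B i f phi (top_of d))%O -> d \in S) ->
    finitely_many (fun d => (z <= diag (top_of d))%O).
  by move=> zS; exists S => d /le_prodE[]; exact: zS.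
have top_of_inj c d : top_of c = top_of d -> c = d by case.
case: z finP => x y /= finP; case: x finP => [g n|[c u]|] finP; last first.
- by left; apply: (finP [::]) => d /le_P1B.
- case: u finP => [v|] finP; last first.
    left; apply: (finP [:: c]) => d /le_P1B /top_of_le /top_of_inj -> _.
    exact: mem_head.
  case: y finP => [h n k|[c' u']|] finP; last first.
  + by left; apply: (finP [::]) => d _ /le_P2B.
  + case: u' finP => [v'|] finP; last first.
      left; apply: (finP [:: c']) => d _ /le_P2B /top_of_le /top_of_inj ->.
      exact: mem_head.
    have [[S fin]|le1|le2] := common_tops c c' v v'.
    * left; apply: (finP S) => d /le_P1B ? /le_P2B ?; exact: fin.
    * right; exists c, c', v, v'; split=> //; left.
      apply/le_prodE; rewrite le_P1B le_P2B; split=> //=; case: v {finP le1} => p w.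
      by apply/sqle_top_of; left.
    * right; exists c, c', v, v'; split=> //; right.
      apply/le_prodE; rewrite le_P1B le_P2B; split=> //=; case: v' {finP le2} => p w.
      by apply/sqle_top_of; left.
  (* The value of [h] at [m] lies in [i (phi m)], so it can be of the form [f p s] only for
     [m = psi p]. *)
  + left; case: v finP => p w finP; case: phi_bij => psi phiK psiK.
    apply: (finP [:: c; (sval h (psi p), k)]) => d /le_P1B /sqle_top_of.
    case=> [->|[s ds _]]; first by rewrite inE eqxx.
    move=> /le_P2B[m _ /top_of_inj dE]; rewrite dE /= in ds *.
    have -> : psi p = m.
      apply: (can_inj phiK); rewrite psiK.
      by apply: (@i_eq _ _ (f p s)) => //; rewrite -ds; exact: (svalP h m).
    by rewrite !inE eqxx orbT.
- left; case: y finP => [h n' k|[c' u']|] finP.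
  + apply: (finP [:: (g k, k)]) => d /le_P1B[m _ /top_of_inj ->].
    by move=> /le_P2B[m' _ [_ <-]]; exact: mem_head.
  (* Tops above an element of level [c'.2] have level at most [c'.2.+1], and [g] offers one top per
     level. *)
  + apply: (finP [seq (g m, m) | m <- iota 0 c'.2.+2]).
    move=> d /le_P1B[m _ /top_of_inj ->] /le_P2B dc'; apply/mapP; exists m => //.
    rewrite mem_iota add0n; case: u' dc' {finP} => [[p w] /sqle_top_of|]; last first.
      by move=> /top_of_le /top_of_inj <- /=; rewrite ltnS leqnSn.
    case=> [<-|[s _]] /=; first by rewrite ltnS leqnSn.
    by case: w => [x [[_ -> _]|[-> _]]|t [_ -> _]]; rewrite ?ltnS ?leqnSn.
  + by apply: (finP [::]) => d _ /le_P2B.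
Qed.

(** * Scott closedness *)

Definition diag_down : set P1P2 :=
  [set z | exists d, (z <= diag (top_of d))%O].

Lemma diag_down_closed : closed (diag_down : set (Sigma P1P2)).
Proof.
rewrite -openC open_SigmaE; split=> [x y xA xy [d yd]|D s dD [s_ub s_lub] sA].
  by apply: xA; exists d; exact: le_trans yd.
apply: contrapT => DA; apply: sA.
have {}DA z : D z -> diag_down z.
  by move=> Dz; apply: contrapT => zA; apply: DA; exists z.
suff [t Dt] : exists t, forall z, D z -> (z <= diag (top_of t))%O.
  by exists t; apply: s_lub => z; exact: Dt.
have anti : forall (y z : P1P2) t, (y <= z)%O ->
    (z <= diag (top_of t))%O -> (y <= diag (top_of t))%O.
  by move=> y z t; exact: le_trans.
have [[z [Dz [S zS]]]|no_fin] :=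
  pselect (exists z, D z /\ finitely_many (fun d => (z <= diag (top_of d))%O)).
  apply: (directed_common_bound (S := S) anti dD Dz) => y /DA[t yt] zy.
  by exists t => //; apply: zS; exact: le_trans yt.
have {}no_fin z : D z -> exists c c' v v',
    z = (P1B f (c, Some v), P2B i f phi (c', Some v')) /\
    ((z <= diag (top_of c))%O \/ (z <= diag (top_of c'))%O).
  by move=> Dz; case: (common_tops_pair z) => // fin; case: no_fin; exists z.
have [x Dx] := dD.1; have [c [c' [v [v' [xE _]]]]] := no_fin _ Dx.
(* No element of [D] has only finitely many tops above it, so all those above [x] keep the positions
   [c] and [c'] and lie below one of these two tops. *)
apply: (directed_common_bound (S := [:: c; c']) anti dD Dx) => y Dy.
have [e [e' [u [u' [yE yle]]]]] := no_fin _ Dy.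
rewrite xE {1}yE => /le_prodE[/= /P1B_le ce /P2B_le ce'].
have same a (va vb : ltpair * M) b : sqle (a, Some va) (b, Some vb) -> a = b.
  by case=> [[]//|/sqlt_cases[/sq1E[]//|[m [n]]]].
rewrite (same _ _ _ _ ce) (same _ _ _ _ ce').
by case: yle => ?; [exists e|exists e'] => //; rewrite !inE eqxx ?orbT.
Qed.

(** * Scott open sets along the diagonal *)

(** An upper bound inside a copy of [L] contradicts unboundedness. A top other than that of [c] has
    index [f p s] with the same [s] for all [k], which bounds the branch by [escape_bound]. *)
Lemma branch_lub c p (w : nat -> M) b :
    (forall k, leM (w 0) (w k)) -> ~ (exists v, forall k, leM (w k) v) ->
    (forall k, sqle (c, Some (p, w k)) b) ->
  sqle (top_of c) b.
Proof.
case: b => d [[q v]|] w0 unbounded wb.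
  case: unbounded; exists v => k; case: (wb k) => [[_ _ ->]|]; first exact: leM_refl.
  by move=> /sqlt_cases[/sq1E[_ /andP[_ /andP[]]]|[m [n]]].
have [->|/eqP dc] := eqVneq d c; first by left.
have esc k : exists2 s, d.1 = f p s & escape c p (w k) s d.2.
  by have /sqle_top_of[] := wb k.
have [s ds _] := esc 0; case: unbounded.
have ws k : leM (w k) (inr s) \/ leM (w k) (inl (last 0 (val s))).
  have [t dt /escape_bound] := esc k.
  by rewrite (_ : s = t) //; apply: (@f_inj p); rewrite -ds.
(* Comparable elements of [M] are of the same kind, so [w 0] decides which of the two bounds
   applies. *)
exists (match w 0 with inl _ => inl (last 0 (val s)) | inr _ => inr s end) => k.
by case: (w 0) (w k) (w0 k) (ws k) => [?|?] [?|?] //= _ [].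
Qed.

(** Applied in both coordinates, [branch_lub] makes the diagonal top the supremum of the diagonal
    branch. *)
Lemma open_branch (U : set P1P2) c p (w : nat -> M) :
    (forall m n, (m <= n)%N -> leM (w m) (w n)) ->
    ~ (exists v, forall k, leM (w k) v) ->
    scott_open U -> U (diag (top_of c)) ->
  exists k, U (diag (c, Some (p, w k))).
Proof.
move=> w_mono unbounded [_ U_open] Uc.
pose u k := diag (c, Some (p, w k)).
have u_dir : directed (range u).
  apply: directed_chain => m n mn; apply: diag_le.
  have /(sq1_leM c p)[e|lt] := w_mono _ _ mn; [by left|by right; left].
suff u_lub : supremums (range u) (diag (top_of c)).
  by have [_ [[k _ <-] Uk]] := U_open _ _ u_dir u_lub Uc; exists k.
have lub := @branch_lub c p w _ (fun k => w_mono 0 k (leq0n k)) unbounded.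
split=> [_ [k _ <-]|z zub]; first by apply/diag_le/sqle_top_of; left.
have {}zub k : (u k <= z)%O by apply: zub; exists k.
case: z zub => x y zub; apply/le_prodE => /=; split.
  apply/P1B_le; case: x zub => [g n|b|] zub //.
    by have /le_prodE[/P1B_le] := zub 0.
  by apply: lub => k; have /le_prodE[/P1B_le] := zub k.
apply/P2B_le; case: y zub => [g n k|b|] zub //.
  by have /le_prodE[_ /P2B_le] := zub 0.
by apply: lub => k; have /le_prodE[_ /P2B_le] := zub k.
Qed.

Lemma open_nat (U : set P1P2) c p :
  scott_open U -> U (diag (top_of c)) -> exists x, U (diag (c, Lnat p x)).
Proof.
apply: open_branch => // -[[m|s] bound]; last by have := bound 0.
by have := bound m.+1; rewrite /= ltnn.
Qed.

Lemma open_words (U : set P1P2) c p (w : nat -> word) :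
    (forall k, exists x, w k.+1 = word_rcons (w k) x) ->
    scott_open U -> U (diag (top_of c)) ->
  exists k, U (diag (c, Lword p (w k))).
Proof.
move=> w_step; apply: (@open_branch _ _ _ (fun k => inr (w k))) => [m n|[v bound]].
  move=> /subnK <-; elim: (n - m) => [|k IHk]; first exact: leM_refl.
  apply: leM_trans IHk _; rewrite addSn; have [x ->] := w_step (k + m).
  exact: prefix_rcons.
(* The lengths grow without limit, so no single word has all the [w k] as prefixes. *)
have size_w k : size (val (w k)) = (size (val (w 0)) + k)%N.
  elim: k => [|k IHk]; first by rewrite addn0.
  by have [x ->] := w_step k; rewrite /= size_rcons IHk addnS.
case: v bound => [m /(_ 0)//|s /(_ (size (val s)).+1)/size_prefix].
by rewrite size_w addnS ltnNge leq_addl.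
Qed.

Lemma open_upper (U : set P1P2) b c :
  scott_open U -> sqle b c -> U (diag b) -> U (diag c).
Proof. by move=> [U_upper _] bc /U_upper; apply; exact: diag_le. Qed.

(* Because of [sq3], [U] contains the top indexed by some one-letter word on
   level [n.+1]; from there, [sq4] yields an infinite branch of words all of
   whose indices belong to [U]. The branch converges to [top_of (pfst p, n)],
   so it enters [V], and [sq2] brings [V] to the same level. *)
Lemma opens_meet_next (U V : set P1P2) p n :
    scott_open U -> scott_open V ->
    U (diag (top_of (psnd p, n))) -> V (diag (top_of (pfst p, n))) ->
  exists j, U (diag (top_of (j, n.+1))) /\ V (diag (top_of (j, n.+1))).
Proof.
move=> oU oV Ub Va.
have [x Ux] := open_nat p oU Ub.
have Ux1 : U (diag (top_of (f p (word1 x), n.+1))).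
  by apply: open_upper oU _ Ux; right; do 2!right; left; exact: Sq3.
have next s : exists y, U (diag (top_of (f p s, n.+1))) ->
    U (diag (top_of (f p (word_rcons s y), n.+1))).
  (* The letter 0 is a mere default, making the choice of [y] total in [s]. *)
  have [Us|] := pselect (U (diag (top_of (f p s, n.+1)))); last by exists 0.
  have [y Uy] := open_nat p oU Us; exists y => _.
  by apply: open_upper oU _ Uy; right; do 3!right; left; exact: Sq4.
have [nx nxP] := choice next.
pose w := fix w k := if k is k'.+1 then word_rcons (w k') (nx (w k')) else word1 x.
have Uw k : U (diag (top_of (f p (w k), n.+1))).
  by elim: k => [//|k IHk]; exact: nxP.
have [|k Vk] := @open_words _ _ p w _ oV Va.
  by move=> k; exists (nx (w k)).
exists (f p (w k)); split=> //.
by apply: open_upper oV _ Vk; right; right; left; exact: Sq2.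
Qed.

Lemma open_next (U : set P1P2) j n : scott_open U ->
  U (diag (top_of (j, n))) -> exists j', U (diag (top_of (j', n.+1))).
Proof.
(* The whole space serves as the other open set, so any second index larger than [j] would do. *)
move=> oU Uj; pose p : ltpair := exist _ (j, j.+1) (ltnSn j).
by have [|j' [_ ?]] := @opens_meet_next _ _ p n scott_openT oU _ Uj; last exists j'.
Qed.

Lemma open_raise (U : set P1P2) j n k : scott_open U ->
  U (diag (top_of (j, n))) -> exists j', U (diag (top_of (j', n + k))).
Proof.
move=> oU Uj; elim: k => [|k [j' Uj']]; first by exists j; rewrite addn0.
by rewrite addnS; exact: open_next Uj'.
Qed.

Lemma opens_meet (U V : set P1P2) c d : scott_open U -> scott_open V ->
    U (diag (top_of c)) -> V (diag (top_of d)) ->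
  exists e, U (diag (top_of e)) /\ V (diag (top_of e)).
Proof.
case: c d => j n [k m] oU oV /(open_raise m oU)[{}j Uj] /(open_raise n oV)[{}k].
(* Both tops are now on level [n + m]; the set whose index is larger takes the role of [U] in
   [opens_meet_next]. *)
rewrite addnC => Vk; case: (ltngtP j k) => [jk|kj|jk].
- pose p : ltpair := exist _ (j, k) jk.
  by have [e []] := @opens_meet_next _ _ p _ oV oU Vk Uj; exists (e, (n + m).+1).
- pose p : ltpair := exist _ (k, j) kj.
  by have [e []] := @opens_meet_next _ _ p _ oU oV Uj Vk; exists (e, (n + m).+1).
- by exists (j, n + m); rewrite {2}jk.
Qed.

(** * Irreducibility and failure of sobriety *)

Lemma diag_down_irreducible :
  irreducible_set (diag_down : set (Sigma P1P2)).
Proof.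
split=> [|F G clF clG AFG].
  by exists (diag (top_of (0, 0))), (0, 0); exact: le_refl.
(* Closed sets are lower sets, so one that fails to contain [diag_down] already misses a diagonal
   top. *)
have escapes (H : set (Sigma P1P2)) : closed H -> ~ diag_down `<=` H ->
    scott_open (~` H : set P1P2) /\ exists d, ~ H (diag (top_of d)).
  rewrite -openC open_SigmaE => oH AH; split=> //.
  apply: contrapT => allH; apply: AH => z [d zd]; apply: contrapT => Hz.
  by apply: allH; exists d; exact: (oH.1 _ _ Hz zd).
apply: contrapT => /not_orP[/(escapes _ clF)[oF [c Fc]] /(escapes _ clG)[oG [d Gd]]].
have [e [Fe Ge]] := opens_meet oF oG Fc Gd.
by have [] : (F `|` G) (diag (top_of e)) by apply: AFG; exists e; exact: le_refl.
Qed.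

Lemma not_sober_P1P2 : ~ sober (Sigma P1P2).
Proof.
move=> /(_ _ diag_down_closed diag_down_irreducible)[z [zE _]].
have [d zd] : diag_down z by rewrite zE; exact: subset_closure.
(* A generic point would lie above every diagonal top and below that of [d], but distinct tops are
   incomparable. *)
have all_eq c : c = d.
  have /closure1_le cz : closure [set z] (diag (top_of c)).
    by rewrite -zE; exists c; exact: le_refl.
  have /le_prodE[/P1B_le /top_of_le [->] _] := le_trans cz zd.
  by [].
by have := all_eq (0, 0); rewrite -(all_eq (1, 0)).
Qed.

End Counterexample.

Theorem theorem4p11 (i : ltpair -> set nat) (f : ltpair -> word -> nat)
    (phi : nat -> ltpair)
    (i_inj : injective i)
    (i_disj : forall p q : ltpair, p <> q -> i p `&` i q = set0)
    (i_gt : forall (p : ltpair) (k : nat), i p k -> (psnd p < k)%N)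
    (f_in : forall (p : ltpair) (s : word), i p (f p s))
    (f_mono : forall (p : ltpair) (s t : word), word_le s t -> (f p s <= f p t)%N)
    (f_inj : forall p : ltpair, injective (f p))
    (phi_bij : bijective phi) :
  ~ sober (Sigma (P1 f *p P2 i f phi)%type).
Proof. exact: not_sober_P1P2. Qed.
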